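(* Let $A$ be a general metric space that is symmetric, i.e. $A(x,y)=A(y,x)$ for all $x,y$. Then: (1) flat filters on $A$ are Cauchy; (2) for any Cauchy filter $\mathcal{F}$ on $A$, $M^l(\mathcal{F})=M^r(\mathcal{F})$ (as maps $A\to[0,\infty]$); (3) any left adjoint module on $A$ has the same underlying map as its right adjoint; (4) for any left adjoint module $M$ on $A$, $\mathcal{F}(M)=\mathcal{F}^s(M)$; (5) $\mathcal{P}_2$-flat modules on $A$ are left adjoint; (6) closed Cauchy filters on $A$ are exactly the minimal Cauchy filters; (7) $CFFil(A)$ is discrete.
   Context: $[0,\infty]$ carries $[u,v]$ = truncated subtraction $\max(v-u,0)$, with $[\infty,v]=0$ for all $v$ and $[u,\infty]=\infty$ for $u<\infty$. A general metric space is a set $A$ with $A(-,-):A\times A\to[0,\infty]$ such that $A(x,x)=0$ and $A(y,z)+A(x,y)\ge A(x,z)$. A left module on $A$ is $M:A\to[0,\infty]$ with $M(y)+A(x,y)\ge M(x)$; a right module is $N:A\to[0,\infty]$ with $A(x,y)+N(x)\ge N(y)$. ''Module on $A$'' in the claim means left module. A left module $M$ is left adjoint to a right module $N$ if $\inf_{x}(M(x)+N(x))=0$ and $N(y)+M(x)\ge A(x,y)$ for all $x,y$; the right adjoint of $M$, when it exists, is unique and written $\tilde M$. Filters are proper (all members non-empty). A filter $\mathcal{F}$ on $A$ is Cauchy if $\inf_{f\in\mathcal{F}}\sup_{x,y\in f}A(x,y)=0$; minimal Cauchy means minimal for inclusion among Cauchy filters. For Cauchy $\mathcal{F}$, $M^l(\mathcal{F})(x)=\inf_{f\in\mathcal{F}}\sup_{y\in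 f}A(x,y)=\sup_{f\in\mathcal{F}}\inf_{y\in f}A(x,y)$ and $M^r(\mathcal{F})(x)=\inf_{f\in\mathcal{F}}\sup_{y\in f}A(y,x)=\sup_{f\in\mathcal{F}}\inf_{y\in f}A(y,x)$. For any filter, $M^-(\mathcal{F})(x)=\sup_{f\in\mathcal{F}}\inf_{y\in f}A(x,y)$. For a left module $M$, $\mathcal{F}(M)$ is the collection of subsets of $A$ containing some $\{x\mid M(x)\le\epsilon\}$, $\epsilon\in\,]0,\infty]$. For a left adjoint module $M$, $\mathcal{F}^s(M)$ is the collection of subsets containing some $\{x\mid M(x)+\tilde M(x)\le\epsilon\}$, $\epsilon\in\,]0,\infty]$. $\mathcal{F}$ is weakly flat if for every $\epsilon>0$ there is $f\in\mathcal{F}$ such that for all $x\in f$, $g\in\mathcal{F}$ there is $y\in g$ with $A(x,y)\le\epsilon$; flat if for every $\epsilon>0$ there is $f\in\mathcal{F}$ such that for every finite family $(x_i)$ in $f$ and every $g\in\mathcal{F}$ there is $y\in g$ with $A(x_i,y)\le\epsilon$ for all $i$. (Cauchy filters are flat, flat filters are weakly flat.) A weakly flat filter $\mathcal{F}$ is closed if $\mathcal{F}=\mathcal{F}(M^-(\mathcal{F}))$. $CFFil(A)$ is the poset (category) of closed flat filters on $A$ with an arrow $\mathcal{F}_1\to\mathcal{F}_2$ iff $\mathcal{F}_1\supseteq\mathcal{F}_2$. A left module $M$ is $\mathcal{P}_2$-flat if $N\mapsto\inf_x(M(x)+N(x))$ on right modules preserves all limits whose index is a functor on a general metric space with finitely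 many points; explicitly: for every general metric space $K$ with finitely many points, every $F:K\to[0,\infty]$ with $K(k,l)+F(k)\ge F(l)$, and every family $(L_k)_{k\in K}$ of right modules on $A$ with $K(k,l)+L_k(x)\ge L_l(x)$, $$\inf_{x\in A}\Big(M(x)+\sup_{k\in K}[F(k),L_k(x)]\Big)=\sup_{k\in K}\Big[F(k),\inf_{x\in A}(M(x)+L_k(x))\Big].$$ *)

(* Defs.v *)
From mathcomp Require Import all_boot all_order all_algebra.
From mathcomp Require Import boolp classical_sets filter reals constructive_ereal.
From mathcomp Require Import ereal.

Set Implicit Arguments.
Unset Strict Implicit.
Unset Printing Implicit Defensive.

Import Order.TTheory GRing.Theory Num.Theory.

Local Open Scope classical_set_scope.
Local Open Scope ereal_scope.

(** The interval [0, oo] is represented by the nonnegative elements of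
    [\bar R]; every map into it carries an explicit nonnegativity condition. *)

(** Infima in [0, oo] agree with [ereal_inf] (both are [+oo] on [set0]), but the
    supremum of the empty set is [0] in [0, oo] whereas [ereal_sup set0 = -oo]. *)
Definition sup0 (R : realType) (S : set (\bar R)) : \bar R :=
  ereal_sup (0 |` S).

(** Truncated subtraction [u, v]; for [u < +oo] and [v = +oo] it is [+oo]. *)
Definition tsub (R : realType) (u v : \bar R) : \bar R :=
  if u == +oo then 0 else maxe (v - u) 0.

Record gmetric (R : realType) (A : Type) := GMetric {
  gdist :> A -> A -> \bar R;
  gdist_ge0 : forall x y, 0 <= gdist x y;
  gdist_refl : forall x, gdist x x = 0;
  gdist_triangle : forall x y z, gdist x z <= gdist y z + gdist x y
}.

Definition gsymmetric (R : realType) (A : Type) (d : gmetric R A) : Prop :=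
  forall x y, d x y = d y x.

Section Modules.
Context (R : realType) (A : Type) (d : gmetric R A).
Implicit Types (M N : A -> \bar R).

Definition left_module M : Prop :=
  (forall x, 0 <= M x) /\ (forall x y, M x <= M y + d x y).

Definition right_module N : Prop :=
  (forall x, 0 <= N x) /\ (forall x y, N y <= d x y + N x).

Definition pairing M N : \bar R := ereal_inf [set M x + N x | x in [set: A]].

Definition adjoint M N : Prop :=
  [/\ left_module M, right_module N,
      pairing M N = 0 & forall x y, d x y <= N y + M x].

Definition left_adjoint M : Prop := exists N, adjoint M N.

(** So the N in [adjoint M N] is the right adjoint of M. *)
Lemma adjoint_uniq M N N' : adjoint M N -> adjoint M N' -> N = N'.
Proof.
have le_adj N1 N2 : adjoint M N1 -> adjoint M N2 -> forall y, N1 y <= N2 y.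
  move=> [_ [N1ge0 N1r] MN1 _] [[Mge0 _] [N2ge0 _] _ N2d] y.
  apply/lee_addgt0Pr => e e0.
  have : pairing M N1 < e%:E by rewrite MN1 lte_fin.
  move=> /ereal_inf_lt[_ [x _ <-]] xe.
  apply: (le_trans (N1r x y)).
  apply: (le_trans (leeD2r (N1 x) (N2d x y))).
  by rewrite -addeA leeD2l// ltW.
by move=> MN MN'; apply/funext => y; apply/le_anti; rewrite !le_adj.
Qed.

End Modules.

Section Filters.
Context (R : realType) (A : Type) (d : gmetric R A).
Implicit Types (M N : A -> \bar R) (F : set_system A).

Definition cauchy_filter F : Prop :=
  ereal_inf [set sup0 [set d xy.1 xy.2 | xy in f `*` f] | f in F] = 0.

Definition min_cauchy_filter F : Prop :=
  cauchy_filter F /\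
  forall G : set_system A,
    ProperFilter G -> cauchy_filter G -> G `<=` F -> G = F.

Definition Ml F (x : A) : \bar R :=
  ereal_inf [set sup0 [set d x y | y in f] | f in F].

Definition Mr F (x : A) : \bar R :=
  ereal_inf [set sup0 [set d y x | y in f] | f in F].

Definition Mminus F (x : A) : \bar R :=
  sup0 [set ereal_inf [set d x y | y in f] | f in F].

Definition module_filter M : set_system A :=
  [set f | exists2 eps : \bar R, 0 < eps & [set x | M x <= eps] `<=` f].

(** F^s(M), where N stands for the right adjoint of M. *)
Definition smodule_filter M N : set_system A :=
  [set f | exists2 eps : \bar R, 0 < eps & [set x | M x + N x <= eps] `<=` f].

Definition weakly_flat_filter F : Prop :=
  forall eps : \bar R, 0 < eps ->
    exists2 f, F f & forall x g, f x -> F g -> exists2 y, g y & d x y <= eps.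

Definition flat_filter F : Prop :=
  forall eps : \bar R, 0 < eps ->
    exists2 f, F f &
      forall (n : nat) (x : 'I_n -> A) g, (forall i, f (x i)) -> F g ->
        exists2 y, g y & forall i, d (x i) y <= eps.

Definition closed_filter F : Prop :=
  weakly_flat_filter F /\ F = module_filter (Mminus F).

Record CFFil := MkCFFil {
  cffil_filter :> set_system A;
  cffil_proper : ProperFilter cffil_filter;
  cffil_flat : flat_filter cffil_filter;
  cffil_closed : closed_filter cffil_filter
}.

Definition CFFil_arrow (F1 F2 : CFFil) : Prop :=
  cffil_filter F2 `<=` cffil_filter F1.

(** The limits are those weighted by functors F on a general metric space K
    with finitely many (possibly no) points. *)
Definition P2_flat M : Prop :=
  forall (K : finType) (k : gmetric R K) (F : K -> \bar R)
         (L : K -> A -> \bar R),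
    (forall i, 0 <= F i) ->
    (forall i j, F j <= k i j + F i) ->
    (forall i, right_module d (L i)) ->
    (forall i j x, L j x <= k i j + L i x) ->
    pairing M (fun x => sup0 [set tsub (F i) (L i x) | i in [set: K]]) =
    sup0 [set tsub (F i) (pairing M (L i)) | i in [set: K]].

End Filters.

(** A preorder, seen as a category, is discrete when its only arrows are the
    identities. *)
Definition discrete_arrows (T : Type) (arrow : T -> T -> Prop) : Prop :=
  forall x y, arrow x y -> x = y.

(* Main.v *)
Require Import Defs.
From mathcomp Require Import all_boot all_order all_algebra.
From mathcomp Require Import boolp classical_sets filter reals constructive_ereal.
From mathcomp Require Import ereal.
From mathcomp Require Import lra.

(** Under symmetry, left and right modules coincide and adjointness forces
    [M = N]. For P2-flatness, the empty limit gives [inf M = 0], and the limit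
    over two points at distance [+oo], with representables [d x] and [d y]
    weighted by [M x] and [M y], provides points [z] with [d x z <= M x + e] and
    [d y z <= M y + e], whence [d x y <= M y + M x]. For a Cauchy filter [F],
    the sublevel sets of [Mminus d F] generate a Cauchy filter contained in every
    Cauchy filter included in [F], so it is the minimal one below [F]. *)

Set Implicit Arguments.
Unset Strict Implicit.
Unset Printing Implicit Defensive.

Import Order.TTheory GRing.Theory Num.Theory.
(* Imported again because [reals] has a lemma called [sup0]. *)
Import Defs.

Local Open Scope classical_set_scope.
Local Open Scope ereal_scope.

(** * Suprema and truncated subtraction in [0, oo] *)

Section Sup0.
Context (R : realType).
Implicit Types (S : set (\bar R)) (u v : \bar R).

Lemma sup0_ge0 S : 0 <= sup0 S.
Proof. by apply: ereal_sup_ubound; left. Qed.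

Lemma sup0_ubound S u : S u -> u <= sup0 S.
Proof. by move=> Su; apply: ereal_sup_ubound; right. Qed.

Lemma sup0_le S u : 0 <= u -> (forall s, S s -> s <= u) -> sup0 S <= u.
Proof. by move=> u0 Su; apply: ge_ereal_sup => s [->|/Su]. Qed.

Lemma sup0_eq0 S : (forall s, S s -> s <= 0) -> sup0 S = 0.
Proof. by move=> S0; apply/le_anti; rewrite sup0_ge0 sup0_le. Qed.

Lemma tsub_le0 u v : 0 <= u -> v <= u -> tsub u v <= 0.
Proof.
rewrite /tsub; case: eqP => // uoo u0 vu; rewrite ge_max lexx andbT.
by rewrite sube_le0.
Qed.

(** One half of the adjunction between [tsub u] and addition of [u]. For [u = +oo] the bound is
    trivial; otherwise [u] is finite and can be moved across the inequality. *)
Lemma le_add_tsub u v (e : \bar R) : 0 <= u -> 0 <= e -> tsub u v <= e ->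
  v <= u + e.
Proof.
rewrite /tsub; case: eqP => [-> _ e0 _|uoo u0 e0].
  by rewrite addye ?leey// gt_eqF// (lt_le_trans _ e0)// ltNy0.
rewrite ge_max => /andP[+ _]; rewrite leeBlDl// ge0_fin_numE// lt_neqAle leey.
by rewrite andbT; apply/eqP.
Qed.

(** Replaces a tolerance in ]0, oo] by a real one that can be spent twice; at [+oo] any positive
    real serves. *)
Lemma ereal_half u : 0 < u -> exists2 e : R, (0 < e)%R & e%:E + e%:E <= u.
Proof.
case: u => [r r0||//]; last by exists 1%R => //; rewrite leey.
exists (r / 2)%R; first by rewrite divr_gt0.
by rewrite -EFinD -splitr.
Qed.

Lemma ereal_inf_eq0P (T : Type) (P : set T) (g : T -> \bar R) :
  (forall x, 0 <= g x) ->
  ereal_inf [set g x | x in P] = 0 <->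
  forall e : R, (0 < e)%R -> exists2 x, P x & g x <= e%:E.
Proof.
move=> g0; split=> [inf0 e e0|Pe].
  have : ereal_inf [set g x | x in P] < e%:E by rewrite inf0 lte_fin.
  by move=> /ereal_inf_lt[_ [x Px <-]] /ltW ge; exists x.
apply/le_anti/andP; split; last by apply: le_ereal_inf_tmp => _ [x _ <-].
apply/lee_addgt0Pr => e /Pe[x Px gxe]; rewrite add0e.
by apply: le_trans gxe; apply: ereal_inf_lbound; exists x.
Qed.

End Sup0.

(** * Cauchy filters and the sublevel sets of [Mminus d F] *)

Section CauchyFilters.
Context (R : realType) (A : Type) (d : gmetric R A).
Implicit Types (F G : set_system A).

Lemma cauchy_filterP F : cauchy_filter d F <->
  forall e : R, (0 < e)%R ->
    exists2 f, F f & forall x y, f x -> f y -> d x y <= e%:E.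
Proof.
rewrite /cauchy_filter ereal_inf_eq0P => [|f]; last exact: sup0_ge0.
split=> Fe e e0; have [f Ff fe] := Fe e e0; exists f => //.
  move=> x y fx fy; apply: le_trans fe.
  by apply: sup0_ubound; exists (x, y).
apply: sup0_le; first by rewrite lee_fin ltW.
by move=> _ [[x y] [fx fy] <-]; exact: fe.
Qed.

(** By properness every member of [F] meets [f], and a common point bounds the infimum over that
    member. *)
Lemma Mminus_le F f (x : A) (e : \bar R) : ProperFilter F -> F f -> f x ->
  0 <= e -> (forall y, f y -> d x y <= e) -> Mminus d F x <= e.
Proof.
move=> PF Ff fx e0 fe; apply: sup0_le => // _ [g Fg <-].
have [y [fy gy]] := filter_ex (filterI Ff Fg).
by apply: le_trans (fe y fy); apply: ereal_inf_lbound; exists y.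
Qed.

(** A small member of [G] is also a member of [F], so [Mminus_le] applies at each of its points. *)
Lemma cauchy_Mminus_sublevel F G (e : \bar R) : ProperFilter F ->
  cauchy_filter d G -> G `<=` F -> 0 < e ->
  exists2 g, G g & g `<=` [set x | Mminus d F x <= e].
Proof.
move=> PF /cauchy_filterP Gc GF /ereal_half[r r0 re].
have [g Gg gr] := Gc r r0; exists g => // x gx /=.
have r0' : 0 <= r%:E by rewrite lee_fin ltW.
apply: (@le_trans _ _ r%:E); last by apply: le_trans re; rewrite leeDl.
by apply: (Mminus_le PF (GF _ Gg) gx) => // y; exact: gr.
Qed.

Lemma cauchy_weakly_flat F : ProperFilter F -> cauchy_filter d F ->
  weakly_flat_filter d F.
Proof.
move=> PF /cauchy_filterP Fc e /ereal_half[r r0 re].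
have [f Ff fr] := Fc r r0; exists f => // x g fx Fg.
have [y [fy gy]] := filter_ex (filterI Ff Fg); exists y => //.
apply: (le_trans (fr _ _ fx fy)); apply: le_trans re.
by rewrite leeDl ?lee_fin ?ltW.
Qed.

Lemma module_filter_filter (M : A -> \bar R) : Filter (module_filter M).
Proof.
split=> [|f g [e e0 ef] [e' e'0 e'g]|f g fg [e e0 ef]].
- by exists 1 => //; exact: lte01.
- exists (mine e e'); first by rewrite lt_min e0.
  by move=> x /=; rewrite le_min => /andP[/ef ? /e'g ?].
- by exists e => //; exact: subset_trans fg.
Qed.

(** Closedness puts a sublevel set of [Mminus d F] inside each member of [F], and a Cauchy [G] below
    [F] has a member inside that sublevel set. *)
Lemma closed_min_cauchy F : ProperFilter F -> cauchy_filter d F ->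
  closed_filter d F -> min_cauchy_filter d F.
Proof.
move=> PF Fc [_ FM]; split=> // G PG Gc GF; apply/seteqP; split=> // f.
rewrite FM => -[e e0 ef].
have [g Gg ge] := cauchy_Mminus_sublevel PF Gc GF e0.
by apply: filterS Gg => x /ge /ef.
Qed.

End CauchyFilters.

(** * Flat filters and adjoint modules under symmetry *)

Section Symmetric.
Context (R : realType) (A : Type) (d : gmetric R A) (d_sym : gsymmetric d).

Lemma gdist_le_common (x y z : A) (u v : \bar R) :
  d x z <= u -> d y z <= v -> d x y <= u + v.
Proof.
move=> xz yz; apply: (le_trans (gdist_triangle d x z y)).
by rewrite (d_sym z) addeC leeD.
Qed.

Lemma flat_cauchy (F : set_system A) : ProperFilter F -> flat_filter d F ->
  cauchy_filter d F.
Proof.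
move=> PF Ff; apply/cauchy_filterP => e e0.
have [//|r r0 re] := @ereal_half R e%:E.
have [|f fF fr] := Ff r%:E; first by rewrite lte_fin.
exists f => // x y fx fy.
(* Flatness for the pair [x], [y] gives one point [z] close to both. *)
have [i|z _ zr] := fr 2%N (fun i => if i == ord0 then x else y) f _ fF.
  by case: ifP.
apply: le_trans re.
exact: (gdist_le_common (zr ord0) (zr ord_max)).
Qed.

Lemma Ml_eq_Mr (F : set_system A) : Ml d F = Mr d F.
Proof.
rewrite /Ml /Mr; apply/funext => x.
by under eq_fun do under eq_fun do rewrite d_sym.
Qed.

(** For [x] with [M x + N x] small, [M y <= M x + d x y <= N y + (M x + M x)], and dually
    [N y <= M y + (N x + N x)]. *)
Lemma adjoint_eq (M N : A -> \bar R) : adjoint d M N -> M = N.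
Proof.
move=> [[M0 Ml] [N0 Nr] MN dMN].
have [MN0 _] := @ereal_inf_eq0P R A setT (fun x => M x + N x)
  (fun x => adde_ge0 (M0 x) (N0 x)).
apply/funext => y; apply/le_anti/andP; split; apply/lee_addgt0Pr => e e0;
  have [//|r r0 re] := @ereal_half R e%:E; have [x _ xr] := MN0 MN r r0.
- have Mxr : M x <= r%:E by apply: le_trans xr; rewrite leeDl.
  apply: (le_trans (Ml y x)); rewrite (d_sym y).
  apply: (le_trans (leeD2l _ (dMN x y))).
  by rewrite addeCA leeD2l// (le_trans _ re)// leeD.
- have Nxr : N x <= r%:E by apply: le_trans xr; rewrite leeDr.
  apply: (le_trans (Nr x y)); rewrite (d_sym x).
  apply: (le_trans (leeD2r _ (dMN y x))).
  by rewrite addeAC addeC leeD2l// (le_trans _ re)// leeD.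
Qed.

Lemma adjoint_module_filter (M N : A -> \bar R) : adjoint d M N ->
  module_filter M = smodule_filter M N.
Proof.
move=> MN; rewrite -(adjoint_eq MN); have [[M0 _] _ _ _] := MN.
apply/seteqP; split=> f [e e0 ef].
  by exists e => // x /= Mx; apply: ef; apply: le_trans Mx; rewrite leeDl.
have [r r0 re] := ereal_half e0; exists r%:E; first by rewrite lte_fin.
by move=> x /= Mx; apply: ef; apply: le_trans re; exact: leeD.
Qed.

(** * P2-flat modules are left adjoint *)

Lemma gdist_right_module (x : A) : right_module d (d x).
Proof.
split=> [y|y z]; first exact: gdist_ge0.
exact: gdist_triangle.
Qed.

Definition void_metric : gmetric R void.
Proof. by exists (fun _ _ => 0). Defined.

(** The infinite distance leaves the two weights, and the two modules, free of any mutual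
    condition. *)
Definition two_points : gmetric R bool.
Proof.
exists (fun b c => if b == c then 0 else +oo).
- by move=> b c; case: ifP.
- by move=> b; rewrite eqxx.
- by do 3![case]; rewrite //= ?adde0 ?addye ?addey.
Defined.

Lemma two_points_le (F : bool -> \bar R) : (forall b, 0 <= F b) ->
  forall b c, F c <= two_points b c + F b.
Proof.
move=> F0 b c /=; case: eqP => [->|_]; first by rewrite add0e.
by rewrite addye ?leey// gt_eqF// (lt_le_trans _ (F0 b))// ltNy0.
Qed.

Lemma P2_flat_inf (M : A -> \bar R) : left_module d M -> P2_flat d M ->
  ereal_inf [set M x | x in setT] = 0.
Proof.
move=> [M0 _] Mf.
(* The supremum of the empty set is 0 here, so the empty limit is the zero module. *)
have sup_void (g : void -> \bar R) : sup0 [set g i | i in setT] = 0.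
  by apply: sup0_eq0 => _ [[]].
have /(_ (fun=> 0) (fun _ _ => 0)) := Mf void void_metric.
rewrite !sup_void => <-; try by case.
by congr ereal_inf; apply: eq_imagel => x _; rewrite adde0.
Qed.

Lemma P2_flat_dist (M : A -> \bar R) : left_module d M -> P2_flat d M ->
  forall x y, d x y <= M y + M x.
Proof.
move=> [M0 _] Mf x y.
pose p b := if b then x else y.
have Fp b : 0 <= M (p b) by [].
(* After exchanging limit and pairing, each term vanishes: evaluating at [p b] gives
   [pairing M (d (p b)) <= M (p b)]. *)
have pair0 : pairing M (fun z =>
    sup0 [set tsub (M (p b)) (d (p b) z) | b in [set: bool]]) = 0.
  rewrite (Mf bool two_points (fun b => M (p b)) (fun b => d (p b))) //.
  - apply: sup0_eq0 => _ [b _ <-]; apply: tsub_le0 => //.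
    by apply: ereal_inf_lbound; exists (p b) => //; rewrite gdist_refl adde0.
  - exact: two_points_le.
  - by move=> b; exact: gdist_right_module.
  - move=> b c z; apply: (@two_points_le (fun b => d (p b) z)) => ?.
    exact: gdist_ge0.
have [inf0 _] := @ereal_inf_eq0P R A setT (fun z => M z +
    sup0 [set tsub (M (p b)) (d (p b) z) | b in [set: bool]])
  (fun z => adde_ge0 (M0 z) (sup0_ge0 _)).
apply/lee_addgt0Pr => e e0.
have [//|r r0 re] := @ereal_half R e%:E.
have [z _ zr] := inf0 pair0 r r0.
have pz b : d (p b) z <= M (p b) + r%:E.
  apply: le_add_tsub => //; first by rewrite lee_fin ltW.
  apply: le_trans zr.
  apply: le_trans; last exact: leeDr (M0 z).
  by apply: sup0_ubound; exists b.
apply: (le_trans (gdist_le_common (pz true) (pz false))).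
by rewrite addeACA (addeC (M _)) leeD2l.
Qed.

(** By [adjoint_eq], the only candidate for the right adjoint is [M] itself. *)
Lemma P2_flat_left_adjoint (M : A -> \bar R) : left_module d M ->
  P2_flat d M -> left_adjoint d M.
Proof.
move=> MM Mf; have [M0 Ml] := MM; exists M; split=> //.
- by split=> // x y; rewrite d_sym addeC.
- apply/ereal_inf_eq0P => [x|e e0]; first exact: adde_ge0.
  have [//|r r0 re] := @ereal_half R e%:E.
  have [/(_ (P2_flat_inf MM Mf) r r0)[x _ xr] _] := ereal_inf_eq0P setT M0.
  by exists x => //; apply: le_trans re; exact: leeD.
- exact: P2_flat_dist.
Qed.

(** * Minimal Cauchy filters are closed *)

Lemma cauchy_module_filter (F : set_system A) : ProperFilter F ->
  cauchy_filter d F -> cauchy_filter d (module_filter (Mminus d F)).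
Proof.
move=> PF /cauchy_filterP Fc; apply/cauchy_filterP => e e0.
(* Two points of the sublevel set are joined through [f] at cost 2/5 + 1/5 + 2/5 of [e]. *)
have r0 : (0 < e / 5)%R by rewrite divr_gt0.
have [f Ff fr] := Fc _ r0.
(* The infimum of distances to [f] may not be attained, hence the doubled bound. *)
have r1 : (e / 5 < e / 5 + e / 5)%R by rewrite ltrDl.
exists [set x | Mminus d F x <= (e / 5)%:E].
  by exists (e / 5)%:E; rewrite ?lte_fin.
have near x : Mminus d F x <= (e / 5)%:E ->
    exists2 z, f z & d x z <= (e / 5 + e / 5)%:E.
  move=> xe; have : ereal_inf [set d x y | y in f] < (e / 5 + e / 5)%:E.
    apply: (@le_lt_trans _ _ (e / 5)%:E); last by rewrite lte_fin.
    by apply: le_trans xe; apply: sup0_ubound; exists f.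
  by move=> /ereal_inf_lt[_ [z fz <-]] /ltW xz; exists z.
move=> x y /= /near[z fz xz] /near[w fw yw].
have zy : d y z <= (e / 5 + e / 5)%:E + (e / 5)%:E.
  by apply: gdist_le_common yw _; rewrite fr.
apply: (le_trans (gdist_le_common xz zy)).
by rewrite -!EFinD lee_fin; lra.
Qed.

Lemma min_cauchy_closed (F : set_system A) : ProperFilter F ->
  min_cauchy_filter d F -> closed_filter d F.
Proof.
move=> PF [Fc Fmin]; split; first exact: cauchy_weakly_flat.
have MF : module_filter (Mminus d F) `<=` F.
  move=> f [e e0 ef].
  have [g Fg ge] := cauchy_Mminus_sublevel PF Fc (@subset_refl _ F) e0.
  by apply: filterS Fg; exact: subset_trans ef.
(* The generated filter lies below [F], so it is proper, and minimality identifies the two. *)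
apply/esym/Fmin => //; last exact: cauchy_module_filter.
split; last exact: module_filter_filter.
by move=> /MF; exact: filter_not_empty.
Qed.

(** * Discreteness of [CFFil] *)

Lemma CFFil_eq (F1 F2 : CFFil d) :
  cffil_filter F1 = cffil_filter F2 -> F1 = F2.
Proof.
case: F1 F2 => [F1 p1 f1 c1] [F2 p2 f2 c2] /= F12; subst F2.
by congr MkCFFil; exact: Prop_irrelevance.
Qed.

(** An arrow is an inclusion of Cauchy filters whose larger term [F1], being closed, is minimal. *)
Lemma CFFil_discrete : discrete_arrows (@CFFil_arrow R A d).
Proof.
move=> F1 F2 F21; apply/CFFil_eq/esym.
have [p1 p2] := (cffil_proper F1, cffil_proper F2).
have c1 := flat_cauchy p1 (cffil_flat F1).
have [_ F1min] := closed_min_cauchy p1 c1 (cffil_closed F1).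
exact: F1min p2 (flat_cauchy p2 (cffil_flat F2)) F21.
Qed.

End Symmetric.

Theorem mainTheorem6 (R : realType) (A : Type) (d : gmetric R A)
    (d_sym : gsymmetric d) :
  (* (1) *)
  (forall F : set_system A, ProperFilter F -> flat_filter d F ->
     cauchy_filter d F) /\
  (* (2) *)
  (forall F : set_system A, ProperFilter F -> cauchy_filter d F ->
     Ml d F = Mr d F) /\
  (* (3) *)
  (forall M N : A -> \bar R, adjoint d M N -> M = N) /\
  (* (4) *)
  (forall M N : A -> \bar R, adjoint d M N ->
     module_filter M = smodule_filter M N) /\
  (* (5) *)
  (forall M : A -> \bar R, left_module d M -> P2_flat d M ->
     left_adjoint d M) /\
  (* (6) *)
  (forall F : set_system A, ProperFilter F ->
     ((cauchy_filter d F /\ closed_filter d F) <-> min_cauchy_filter d F)) /\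
  (* (7) *)
  discrete_arrows (@CFFil_arrow R A d).
Proof.
split; first by move=> F; exact: flat_cauchy.
split; first by move=> F _ _; exact: Ml_eq_Mr.
split; first exact: adjoint_eq.
split; first exact: adjoint_module_filter.
split; first exact: P2_flat_left_adjoint.
split; last exact: CFFil_discrete.
move=> F PF; split=> [[Fc Fcl]|Fmin]; first exact: closed_min_cauchy.
by split; [case: Fmin|exact: min_cauchy_closed].
Qed.
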